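(* Let $n\ge 1$ be an integer. For any graph $G=(M,E)$ with $\mathcal{C}(G)\le n$, every problem instance $([n],M,V,G)$ has an EF1 allocation, and such an allocation can be found in polynomial time.
   Context: A problem instance is a quadruple $(N,M,V,G)$, where $N$ is a finite set of $n$ agents, $M$ is a finite set of $m$ items, $V$ is a family of additive valuation functions $v_i:2^M\to\mathbb{R}_{\ge 0}$, $i\in N$ (write $v_{ij}=v_i(\{j\})$), and $G=(M,E)$ is an undirected (simple) conflict graph on the items. Here $[n]=\{1,\dots,n\}$. An allocation is an ordered partition $A=\langle A_i\rangle_{i\in N}$ of all of $M$ into $|N|$ (possibly empty) bundles; it is feasible if every bundle is an independent set of $G$. A feasible allocation $A$ is EF1 (envy-free up to one good) if for all $i,i'\in N$ with $A_{i'}\neq\emptyset$, $v_i(A_i)\ge v_i(A_{i'})-\max_{j\in A_{i'}}v_{ij}$. $\mathcal{C}(G)$ denotes the number of vertices in the largest connected component of $G$. Polynomial time is measured in the number of agents and items. *)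

(* Defs.v *)
From HB Require Import structures.
From mathcomp Require Import all_boot all_order all_algebra.
From mathcomp Require Import reals.

Set Implicit Arguments.
Unset Strict Implicit.
Unset Printing Implicit Defensive.

Import Order.TTheory GRing.Theory Num.Theory.

Record graph (M : finType) := Graph {
  edge :> rel M;
  edge_sym : symmetric edge;
  edge_irrefl : irreflexive edge }.

Record valuation (R : realType) (M : finType) := Valuation {
  value :> {set M} -> R;
  value_ge0 : forall S, (0 <= value S)%R;
  value_additive : forall S, (value S = \sum_(j in S) value [set j])%R }.

Definition max_component (M : finType) (G : graph M) : nat :=
  \max_(x : M) #|[set y | connect G x y]|.

Section Allocations.
Variables (R : realType) (N M : finType).
Implicit Type A : {ffun N -> {set M}}.

Definition allocation A : Prop :=
  (forall i i', i != i' -> [disjoint A i & A i']) /\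
  \bigcup_(i : N) A i = [set: M].

Definition independent (G : graph M) (S : {set M}) : Prop :=
  forall x y, x \in S -> y \in S -> ~~ G x y.

Definition feasible (G : graph M) A : Prop :=
  forall i, independent G (A i).

(* The unit 0 of the iterated maximum is harmless: values are nonnegative and
   the maximum is only used on nonempty bundles. *)
Definition EF1 (V : N -> valuation R M) A : Prop :=
  forall i i', A i' != set0 ->
    (V i (A i) >= V i (A i')
                  - \big[Num.max/0]_(j in A i') V i [set j])%R.

Definition EF1_allocation (V : N -> valuation R M) (G : graph M) A : Prop :=
  [/\ allocation A, feasible G A & EF1 V A].

End Allocations.

(* Model of computation: while programs on a unit-cost real RAM.  The memory
   consists of two-dimensional arrays of naturals and of reals, both named by
   naturals; the scalar variable named a is the cell a[0, 0].  Programs contain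
   no real constant except 0, so they do not depend on R.  There is no
   multiplication and no conversion between reals and naturals: in t steps the
   bit length of a number grows by O(t) only, so that unit cost is not abused. *)

Inductive nexp : Type :=
  | NConst of nat
  | NGet of nat & nexp & nexp
  | NAdd of nexp & nexp
  | NSub of nexp & nexp.

Inductive rexp : Type :=
  | RZero
  | RGet of nat & nexp & nexp
  | RAdd of rexp & rexp
  | RSub of rexp & rexp.

Inductive test : Type :=
  | NLe of nexp & nexp
  | RLe of rexp & rexp
  | TNot of test
  | TAnd of test & test.

Inductive cmd : Type :=
  | Skip
  | NSet of nat & nexp & nexp & nexp  (* NSet a i j e is a[i, j] := e *)
  | RSet of nat & nexp & nexp & rexp
  | Seq of cmd & cmd
  | If of test & cmd & cmd
  | While of test & cmd.

Definition update (T : Type) (mem : nat -> nat -> nat -> T) (a i j : nat)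
    (v : T) : nat -> nat -> nat -> T :=
  fun a' i' j' => if [&& a' == a, i' == i & j' == j] then v else mem a' i' j'.

Section Semantics.
Variable R : realType.

Record state := State {
  nmem : nat -> nat -> nat -> nat;
  rmem : nat -> nat -> nat -> R }.

Fixpoint neval (s : state) (e : nexp) : nat :=
  match e with
  | NConst k => k
  | NGet a i j => nmem s a (neval s i) (neval s j)
  | NAdd e1 e2 => neval s e1 + neval s e2
  | NSub e1 e2 => neval s e1 - neval s e2
  end.

Fixpoint reval (s : state) (e : rexp) : R :=
  match e with
  | RZero => 0%R
  | RGet a i j => rmem s a (neval s i) (neval s j)
  | RAdd e1 e2 => (reval s e1 + reval s e2)%R
  | RSub e1 e2 => (reval s e1 - reval s e2)%R
  end.

Fixpoint teval (s : state) (b : test) : bool :=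
  match b with
  | NLe e1 e2 => neval s e1 <= neval s e2
  | RLe e1 e2 => (reval s e1 <= reval s e2)%R
  | TNot b1 => ~~ teval s b1
  | TAnd b1 b2 => teval s b1 && teval s b2
  end.

Definition nset (s : state) (a i j k : nat) : state :=
  State (update (nmem s) a i j k) (rmem s).

Definition rset (s : state) (a i j : nat) (r : R) : state :=
  State (nmem s) (update (rmem s) a i j r).

(* exec c s s' t: started in s, the program c halts in s' after t steps.  Each
   executed assignment or test is one step; the expressions occurring in a
   fixed program have bounded size, so counting the operations inside them
   would change t by a constant factor only. *)
Inductive exec : cmd -> state -> state -> nat -> Prop :=
  | ExecSkip s : exec Skip s s 1
  | ExecNSet a i j e s :
      exec (NSet a i j e) s
           (nset s a (neval s i) (neval s j) (neval s e)) 1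
  | ExecRSet a i j e s :
      exec (RSet a i j e) s
           (rset s a (neval s i) (neval s j) (reval s e)) 1
  | ExecSeq c1 c2 s s1 s2 t1 t2 :
      exec c1 s s1 t1 -> exec c2 s1 s2 t2 -> exec (Seq c1 c2) s s2 (t1 + t2)
  | ExecIfTrue b c1 c2 s s1 t :
      teval s b -> exec c1 s s1 t -> exec (If b c1 c2) s s1 t.+1
  | ExecIfFalse b c1 c2 s s1 t :
      ~~ teval s b -> exec c2 s s1 t -> exec (If b c1 c2) s s1 t.+1
  | ExecWhileFalse b c s :
      ~~ teval s b -> exec (While b c) s s 1
  | ExecWhileTrue b c s s1 s2 t1 t2 :
      teval s b -> exec c s s1 t1 -> exec (While b c) s1 s2 t2 ->
      exec (While b c) s s2 (t1 + t2).+1.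

Lemma exec_det c s s1 s2 t1 t2 :
  exec c s s1 t1 -> exec c s s2 t2 -> s1 = s2 /\ t1 = t2.
Proof.
move=> H; elim: H s2 t2 => {c s s1 t1};
  [move=> s|move=> a i j e s|move=> a i j e s|move=> c1 c2 s s1 s2 t1 t2 _ IH1 _ IH2
  |move=> b c1 c2 s s1 t Hb _ IH1|move=> b c1 c2 s s1 t Hb _ IH1|move=> b c s Hb
  |move=> b c s s1 s2 t1 t2 Hb _ IH1 _ IH2] => s' t' H; inversion H; subst;
repeat match goal with
| Hb : is_true ?x, Hn : is_true (~~ ?x) |- _ => by rewrite Hb in Hn
| IH : (forall s2 t2, exec ?c ?s s2 t2 -> _), E : exec ?c ?s _ _ |- _ =>
    case: (IH _ _ E) => ? ?; subst; clear E
end; by [].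
Qed.

End Semantics.

(* Items are presented to a program by their ranks 0, ..., #|M| - 1 in the
   enumeration of M. *)
Definition item (M : finType) (k : nat) : option M :=
  omap enum_val (insub k : option 'I_#|M|).

(* Natural scalar 0 holds n, natural scalar 1 holds #|M|, natural array 2 is
   the adjacency matrix of G, and real array 0 holds the values v_ij of the
   single items.  All other cells contain 0. *)
Definition input (R : realType) (n : nat) (M : finType)
    (V : 'I_n -> valuation R M) (G : graph M) : state R :=
  State
    (fun a i j =>
       match a, i, j with
       | 0, 0, 0 => n
       | 1, 0, 0 => #|M|
       | 2, _, _ =>
           if (item M i, item M j) is (Some x, Some y) then (G x y : nat) else 0
       | _, _, _ => 0
       end)
    (fun a i j =>
       if a is 0 then
         if (insub i : option 'I_n, item M j) is (Some i', Some x)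
         then V i' [set x] else 0%R
       else 0%R).

(* The owner of the item of rank k is read in cell [k, 0] of natural array 3. *)
Definition output (R : realType) (n : nat) (M : finType) (s : state R) :
    {ffun 'I_n -> {set M}} :=
  [ffun i : 'I_n => [set x : M | nmem s 3 (enum_rank x) 0 == i]].
Arguments output {R} n M s.

(* Main.v *)
Require Import Defs.
From mathcomp Require Import all_boot all_order all_algebra.
From mathcomp Require Import reals boolp zify lra.

(* The components of G are served one after the other, and every agent receives
   at most one item of each component; this is possible because a component has
   at most n items, and it makes every bundle independent.  Before a component
   is served, the bundles are redistributed by top trading cycles: repeatedly,
   every remaining agent points to the remaining agent holding her favourite
   remaining bundle, the bundles are shifted along a cycle, and an agent of the
   cycle is removed.  Nobody loses, so EF1 is preserved, and an agent removed
   earlier does not envy an agent removed later.  The agents then pick their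
   favourite item of the component in the reverse order of removal.  If i picks
   before j, then i values her new item at least as much as that of j, so EF1 of
   i towards j is preserved; and j did not envy i, so removing the new item of i
   removes the envy of j.

   The algorithm is written in a language whose only loops are counted loops
   with n or #|M| iterations, so that it terminates in polynomial time by
   construction and its effect is a function on states. *)

Set Implicit Arguments.
Unset Strict Implicit.
Unset Printing Implicit Defensive.

Import Order.TTheory GRing.Theory Num.Theory.

Inductive prog : Type :=
  | PN of nat & nexp & nexp & nexp
  | PR of nat & nexp & nexp & rexp
  | PSeq of prog & prog
  | PIf of test & prog
  | PFor of nat & nat & prog. (* PFor b a p: for a = 0, ..., b[0, 0] - 1 do p *)

Definition var a := NGet a (NConst 0) (NConst 0).

Fixpoint compile (p : prog) : cmd :=
  match p with
  | PN a i j e => NSet a i j e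
  | PR a i j e => RSet a i j e
  | PSeq p q => Seq (compile p) (compile q)
  | PIf b p => If b (compile p) Skip
  | PFor b a p =>
      Seq (NSet a (NConst 0) (NConst 0) (NConst 0))
          (While (TNot (NLe (var b) (var a)))
             (Seq (compile p)
                  (NSet a (NConst 0) (NConst 0) (NAdd (var a) (NConst 1)))))
  end.

Fixpoint nwrites (p : prog) : seq nat :=
  match p with
  | PN a _ _ _ => [:: a]
  | PR _ _ _ _ => [::]
  | PSeq p q => nwrites p ++ nwrites q
  | PIf _ p => nwrites p
  | PFor _ a p => a :: nwrites p
  end.

Fixpoint rwrites (p : prog) : seq nat :=
  match p with
  | PN _ _ _ _ => [::]
  | PR a _ _ _ => [:: a]
  | PSeq p q => rwrites p ++ rwrites q
  | PIf _ p => rwrites p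
  | PFor _ _ p => rwrites p
  end.

Fixpoint wf (p : prog) : bool :=
  match p with
  | PN a _ _ _ => 1 < a
  | PR _ _ _ _ => true
  | PSeq p q => wf p && wf q
  | PIf _ p => wf p
  | PFor b a p => [&& b < 2, 1 < a, a \notin nwrites p & wf p]
  end.

Fixpoint cost (K : nat) (p : prog) : nat :=
  match p with
  | PN _ _ _ _ | PR _ _ _ _ => 1
  | PSeq p q => cost K p + cost K q
  | PIf _ p => (cost K p).+2
  | PFor _ _ p => (K * (cost K p + 2)).+2
  end.

Arguments nset : simpl never.
Arguments rset : simpl never.

Section Semantics.
Variable R : realType.
Implicit Types s : state R.

Fixpoint sem (p : prog) (s : state R) : state R :=
  match p with
  | PN a i j e => nset s a (neval s i) (neval s j) (neval s e)
  | PR a i j e => rset s a (neval s i) (neval s j) (reval s e)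
  | PSeq p q => sem q (sem p s)
  | PIf b p => if teval s b then sem p s else s
  | PFor b a p =>
      iter (nmem s b 0 0)
        (fun s' => let s1 := sem p s' in nset s1 a 0 0 (nmem s1 a 0 0 + 1))
        (nset s a 0 0 0)
  end.

Lemma nget_nset s a i j k : nmem (nset s a i j k) a i j = k.
Proof. by rewrite /= /update !eqxx. Qed.

Lemma nmem_nset s a i j k d : d != a -> nmem (nset s a i j k) d = nmem s d.
Proof.
by move=> da; apply: funext => i'; apply: funext => j'; rewrite /= /update (negPf da).
Qed.

Lemma rmem_rset s a i j r d : d != a -> rmem (rset s a i j r) d = rmem s d.
Proof.
by move=> da; apply: funext => i'; apply: funext => j'; rewrite /= /update (negPf da).
Qed.

Lemma nmem_sem p s d : d \notin nwrites p -> nmem (sem p s) d = nmem s d.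
Proof.
elim: p s => [a i j e|a i j e|p IHp q IHq|b p IHp|b a p IHp] s //=.
- by rewrite inE => da; apply: nmem_nset.
- by rewrite mem_cat negb_or => /andP[? ?]; rewrite IHq ?IHp.
- by case: ifP => // _; apply: IHp.
- rewrite inE negb_or => /andP[da dp].
  elim: (nmem s b 0 0) => [|k IH]; first by rewrite nmem_nset.
  by rewrite iterS nmem_nset // IHp.
Qed.

Lemma rmem_sem p s d : d \notin rwrites p -> rmem (sem p s) d = rmem s d.
Proof.
elim: p s => [a i j e|a i j e|p IHp q IHq|b p IHp|b a p IHp] s //=.
- by rewrite inE => da; apply: rmem_rset.
- by rewrite mem_cat negb_or => /andP[? ?]; rewrite IHq ?IHp.
- by case: ifP => // _; apply: IHp.
- by move=> dp; elim: (nmem s b 0 0) => [|k IH] //; rewrite iterS IHp.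
Qed.

Lemma wf_nwrites p d : wf p -> d < 2 -> d \notin nwrites p.
Proof.
move=> + d2; elim: p => [a i j e|a i j e|p IHp q IHq|b p IHp|b a p IHp] //=.
- by rewrite inE => a1; rewrite neq_ltn (leq_trans d2).
- by rewrite mem_cat negb_or => /andP[/IHp-> /IHq->].
- by case/and4P=> _ a1 _ /IHp; rewrite inE negb_or neq_ltn (leq_trans d2).
Qed.

Lemma exec_sem p s K : wf p -> nmem s 0 0 0 <= K -> nmem s 1 0 0 <= K ->
  exists2 t, exec (compile p) s (sem p s) t & t <= cost K p.
Proof.
elim: p s => [a i j e|a i j e|p IHp q IHq|b p IHp|b a p IHp] s /=.
- by exists 1 => //; apply: ExecNSet.
- by exists 1 => //; apply: ExecRSet.
- case/andP=> wp wq n0 n1.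
  have [t tp lt] := IHp s wp n0 n1.
  have [||u uq lu] := IHq (sem p s) wq.
  + by rewrite nmem_sem // wf_nwrites.
  + by rewrite nmem_sem // wf_nwrites.
  by exists (t + u); [apply: ExecSeq tp uq | apply: leq_add].
- move=> wp n0 n1; have [t tp lt] := IHp s wp n0 n1.
  case: ifP => hb; first by exists t.+1; [apply: ExecIfTrue | apply: ltnW].
  by exists 2 => //; apply: ExecIfFalse (ExecSkip _); rewrite hb.
case/and4P=> b2 a1 ap wp n0 n1.
have ab : b != a by rewrite neq_ltn (leq_trans b2).
set step := fun s' => _.
set C := While _ _.
have main r s1 : nmem s1 0 0 0 <= K -> nmem s1 1 0 0 <= K ->
    nmem s1 b 0 0 = r + nmem s1 a 0 0 ->
    exists2 t, exec C s1 (iter r step s1) t & t <= (r * (cost K p + 2)).+1.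
  elim: r s1 => [|r IHr] s1 m0 m1 eb.
    by exists 1 => //; apply: ExecWhileFalse; rewrite /= eb leqnn.
  have [t tp lt] := IHp s1 wp m0 m1.
  have keep d : d < 2 -> nmem (step s1) d 0 0 = nmem s1 d 0 0.
    move=> d2; rewrite /step nmem_nset ?nmem_sem ?wf_nwrites //.
    by rewrite neq_ltn (leq_trans d2).
  have [|||u eu lu] := IHr (step s1); rewrite ?(keep 0) ?(keep 1) ?(keep b) //.
    by rewrite eb /step nget_nset nmem_sem // addn1 addSnnS.
  rewrite iterSr; exists ((t + 1) + u).+1.
    apply: (ExecWhileTrue (s1 := step s1)) eu; first by rewrite /= eb -ltnNge ltnS leq_addl.
    by apply: ExecSeq tp _; apply: ExecNSet.
  by rewrite mulSn; lia.
have k0 d : d < 2 -> nmem (nset s a 0 0 0) d = nmem s d.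
  by move=> d2; rewrite nmem_nset // neq_ltn (leq_trans d2).
have [|||t et lt] := main (nmem s b 0 0) (nset s a 0 0 0); rewrite ?(k0 0) ?(k0 1) ?(k0 b) //.
  by rewrite nget_nset addn0.
exists (1 + t); first by apply: ExecSeq et; apply: ExecNSet.
rewrite add1n ltnS (leq_trans lt) // ltnS leq_mul2r.
by case: (b) b2 => [|[|]] //; rewrite ?n0 ?n1 orbT.
Qed.

Lemma sem_PSeq p q s : sem (PSeq p q) s = sem q (sem p s). Proof. by []. Qed.

Lemma sem_PFor (I : nat -> state R -> Prop) b a p s :
  b != a -> a \notin nwrites p ->
  I 0 (nset s a 0 0 0) ->
  (forall k s1, k < nmem s b 0 0 -> nmem s1 a 0 0 = k ->
     (forall d, d \notin a :: nwrites p -> nmem s1 d = nmem s d) ->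
     (forall d, d \notin rwrites p -> rmem s1 d = rmem s d) ->
     I k s1 -> I k.+1 (nset (sem p s1) a 0 0 k.+1)) ->
  I (nmem s b 0 0) (sem (PFor b a p) s).
Proof.
move=> ab ap I0 IS /=; set step := fun s' => _; set r := nmem s b 0 0.
suff [H _ _ _] : [/\ I r (iter r step (nset s a 0 0 0)),
    nmem (iter r step (nset s a 0 0 0)) a 0 0 = r,
    (forall d, d \notin a :: nwrites p ->
       nmem (iter r step (nset s a 0 0 0)) d = nmem s d) &
    (forall d, d \notin rwrites p ->
       rmem (iter r step (nset s a 0 0 0)) d = rmem s d)] by [].
have: r <= nmem s b 0 0 by [].
elim: r => [_|r IH lr].
  split=> // [|d]; first by rewrite nget_nset.
  by rewrite inE negb_or => /andP[da _]; rewrite nmem_nset.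
have [Ir er fn fr] := IH (ltnW lr).
rewrite iterS; set s1 := iter r step _ in Ir er fn fr *.
have -> : step s1 = nset (sem p s1) a 0 0 r.+1.
  by rewrite /step /= nmem_sem // er addn1.
split.
- exact: IS.
- by rewrite nget_nset.
- move=> d dn; have := dn; rewrite inE negb_or => /andP[da dp].
  by rewrite nmem_nset // nmem_sem // fn.
- by move=> d dr; rewrite -fr // -(rmem_sem s1 dr).
Qed.

End Semantics.

Lemma cost_poly p : exists c k, forall K, 0 < K -> cost K p <= c * K ^ k.
Proof.
elim: p => [a i j e|a i j e|p [c [k H]] q [d [l H']]|b p [c [k H]]|b a p [c [k H]]] /=.
- by exists 1, 0.
- by exists 1, 0.
- exists (c + d), (k + l) => K K0; rewrite mulnDl leq_add //.
    by rewrite (leq_trans (H K K0)) // leq_mul2l leq_pexp2l ?leq_addr ?orbT.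
  by rewrite (leq_trans (H' K K0)) // leq_mul2l leq_pexp2l ?leq_addl ?orbT.
- exists (c + 2), k => K K0; rewrite mulnDl -addn2 leq_add ?H //.
  by rewrite leq_pmulr // expn_gt0 K0.
- exists (c + 4), k.+1 => K K0; rewrite -addn2 -[4]/(2 + 2) addnA mulnDl.
  have ? : 0 < K ^ k.+1 by rewrite expn_gt0 K0.
  rewrite leq_add ?leq_pmulr // expnS mulnCA leq_mul2l mulnDl leq_add ?orbT ?H //.
  by rewrite leq_pmulr // expn_gt0 K0.
Qed.

Arguments sem : simpl never.
Arguments nmem : simpl never.
Arguments rmem : simpl never.

(** * Trading cycles and picking sequences *)

Definition inj_below n (f : nat -> nat) :=
  forall i j, i < n -> j < n -> f i = f j -> i = j.

Lemma inj_below_uniq n f : inj_below n f -> uniq (map f (iota 0 n)).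
Proof.
move=> fI; rewrite map_inj_in_uniq ?iota_uniq // => i j.
by rewrite !mem_iota; apply: fI.
Qed.

Lemma inj_below_missed n k f : k < n -> exists2 j, j < n & forall i, i < k -> f i != j.
Proof.
move=> kn; have : ~~ all [in map f (iota 0 k)] (iota 0 n).
  apply/negP => /allP /(uniq_leq_size (iota_uniq 0 n)).
  by rewrite size_map !size_iota leqNgt kn.
case/allPn => j; rewrite mem_iota => /andP[_ jn] jf; exists j => // i ik.
by apply: contra jf => /eqP <-; apply: map_f; rewrite mem_iota.
Qed.

Lemma inj_below_onto n f : inj_below n f -> (forall i, i < n -> f i < n) ->
  forall j, j < n -> exists2 i, i < n & f i = j.
Proof.
move=> fI fn j jn; have sub : {subset map f (iota 0 n) <= iota 0 n}.
  by move=> _ /mapP[i + ->]; rewrite !mem_iota; apply: fn.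
have [] := uniq_min_size (inj_below_uniq fI) sub; first by rewrite size_map.
move=> _ /(_ j); rewrite mem_iota jn => /mapP[i]; rewrite mem_iota => /andP[_ ?] ->.
by exists i.
Qed.

Lemma iter_below n (f : nat -> nat) x k :
  (forall i, i < n -> f i < n) -> x < n -> iter k f x < n.
Proof. by move=> fn xn; elim: k => //= k; apply: fn. Qed.

Lemma iter_periodic n (f : nat -> nat) x :
  (forall i, i < n -> f i < n) -> x < n ->
  exists2 p, 0 < p <= n & iter p f (iter n f x) = iter n f x.
Proof.
move=> fn xn; have : looping f x n.
  apply: contraT; rewrite -looping_uniq => /uniq_leq_size H.
  have : {subset traject f x n.+1 <= iota 0 n}.
    by move=> _ /trajectP[i _ ->]; rewrite mem_iota iter_below.
  by move/H; rewrite size_traject size_iota ltnn.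
case/trajectP => a an e; exists (n - a); first by lia.
by rewrite [in LHS]e -iterD subnK // ltnW.
Qed.

Section Rotation.
Variables (n : nat) (f : nat -> nat) (y p : nat).
Hypotheses (p0 : 0 < p <= n) (yp : iter p f y = y).
Let O := traject f y n.

Lemma orbit_start : y \in O.
Proof. by apply/trajectP; exists 0 => //; lia. Qed.

Lemma orbit_step z : z \in O -> f z \in O.
Proof.
case/trajectP => a an ->; have [an'|an'] := ltnP a.+1 n.
  by apply/trajectP; exists a.+1.
apply/trajectP; exists (a.+1 - p); first by lia.
have e : a.+1 = a.+1 - p + p by lia.
by rewrite -iterS e iterD yp; congr iter; lia.
Qed.

Lemma orbit_periodic z : z \in O -> iter p f z = z.
Proof. by case/trajectP => a _ ->; rewrite -iterD addnC iterD yp. Qed.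

Definition rotate z := if z \in O then f z else z.

Lemma rotate_inj z z' : rotate z = rotate z' -> z = z'.
Proof.
rewrite /rotate; case: ifP => zO; case: ifP => zO' // e.
- rewrite -(orbit_periodic zO) -(orbit_periodic zO').
  by case: p p0 => // q _; rewrite !iterSr e.
- by rewrite -e orbit_step in zO'.
- by rewrite e orbit_step in zO.
Qed.

End Rotation.

Section FairDivision.
Variables (R : realType) (n m : nat) (v : nat -> nat -> R).
Implicit Types (W : nat -> nat -> R) (h bun lab ord p : nat -> nat).

(* other is the value of bundle b for the agent valuing items by vi, and own the
   value of her own bundle. *)
Definition ef1 (vi : nat -> R) bun b (own other : R) : Prop :=
  (other <= own)%R \/
  exists x, [/\ x < m, bun x = b & (other <= own + vi x)%R].

Lemma ef1_mono vi bun bun' b (own own' other other' : R) :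
  (forall x, x < m -> bun x = b -> bun' x = b) ->
  (other' - own' <= other - own)%R ->
  ef1 vi bun b own other -> ef1 vi bun' b own' other'.
Proof.
move=> bb le [H|[x [xm xb H]]]; [left|right]; first by lra.
by exists x; split; rewrite ?bb //; lra.
Qed.

Definition hold_ok h := (forall i, i < n -> 0 < h i <= n) /\ inj_below n h.

Lemma hold_onto h b : hold_ok h -> 0 < b <= n -> exists2 i, i < n & h i = b.
Proof.
case=> hb hI b0.
have [|||i ni e] := @inj_below_onto n (fun i => (h i).-1) _ _ b.-1; try lia.
- by move=> i j ni nj e; apply: hI => //; move: (hb i ni) (hb j nj); lia.
- by move=> i /hb; lia.
- by exists i => //; move: (hb i ni); lia.
Qed.

Section Trading.
Variables (c : nat) (W : nat -> nat -> R) (bun : nat -> nat).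

(* The agents ord 0, ..., ord (k - 1) have been removed; those with done i <= c
   remain. *)
Record trading k h done ord : Prop := Trading {
  trading_hold : hold_ok h;
  trading_ef1 : forall i j, i < n -> j < n ->
    ef1 (v i) bun (h j) (W i (h i)) (W i (h j));
  trading_done : forall i, i < n -> done i <= c.+1;
  trading_ord : forall a, a < k -> ord a < n /\ done (ord a) = c.+1;
  trading_onto : forall i, i < n -> c < done i -> exists2 a, a < k & ord a = i;
  trading_inj : inj_below k ord;
  trading_noenvy : forall a j, a < k -> j < n ->
    done j <= c \/ (exists b, a < b < k /\ ord b = j) ->
    (W (ord a) (h j) <= W (ord a) (h (ord a)))%R }.

Lemma trading_left k h done ord : trading k h done ord -> k < n ->
  exists2 i, i < n & done i <= c.
Proof.
case=> _ _ _ _ onto _ _ /(@inj_below_missed n k ord)[i ni io]; exists i => //.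
by rewrite leqNgt; apply/negP => /(onto i ni)[a /io /eqP].
Qed.

Lemma trading_full h done ord : trading n h done ord ->
  forall i, i < n -> exists2 a, a < n & ord a = i.
Proof.
case=> _ _ _ oo _ oI _; apply: inj_below_onto oI _.
by move=> a /oo[].
Qed.

Lemma trading_step k h done ord f x h' done' ord' :
  trading k h done ord -> x < n -> done x <= c ->
  (forall i, i < n ->
     [/\ f i = i \/ (f i < n /\ done (f i) <= c),
         (W i (h i) <= W i (h (f i)))%R
       & forall j, j < n -> done j <= c -> (W i (h j) <= W i (h (f i)))%R]) ->
  let y := iter n f x in
  (forall i, i < n -> h' i = h (rotate n f y i)) ->
  (forall i, i < n -> done' i = if i == y then c.+1 else done i) ->
  (forall a, a < n -> ord' a = if a == k then y else ord a) ->
  k < n -> trading k.+1 h' done' ord'.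
Proof.
case=> [hok ef dn oo onto oI ne] nx dx ff y hE dE oE kn.
have fn i : i < n -> f i < n by move=> ni; case: (ff i ni) => [[->|[]]].
have fS i : i < n -> done i <= c -> done (f i) <= c.
  by move=> ni di; case: (ff i ni) => [[->|[]]].
have [p p0 yp] : exists2 p, 0 < p <= n & iter p f y = y by apply: iter_periodic.
have ny : y < n by apply: iter_below.
have iS t z : z < n -> done z <= c -> done (iter t f z) <= c.
  by move=> nz dz; elim: t => //= t; apply: fS; apply: iter_below.
have dy : done y <= c by apply: iS.
have OS i : i \in traject f y n -> i < n /\ done i <= c.
  by case/trajectP => t _ ->; split; [apply: iter_below | apply: iS].
have rn i : i < n -> rotate n f y i < n.
  by rewrite /rotate; case: ifP => // _ /fn.
have rS i : i < n -> done i <= c -> done (rotate n f y i) <= c.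
  by rewrite /rotate; case: ifP => // _; apply: fS.
have better i : i < n -> (W i (h i) <= W i (h' i))%R.
  by move=> ni; rewrite hE // /rotate; case: ifP => // _; case: (ff i ni).
have dS j : j < n -> done' j <= c -> done j <= c.
  by move=> nj; rewrite dE //; case: eqP => // _; rewrite ltnn.
have ordS a : a < k -> ord a \notin traject f y n.
  by move=> /oo[_ da]; apply/negP => /OS[_]; rewrite da ltnn.
have ordE a : a < k -> ord' a = ord a.
  by move=> ak; rewrite oE ?(ltn_trans ak) // (ltn_eqF ak).
have ordk : ord' k = y by rewrite oE // eqxx.
have hord a : a < k -> h' (ord a) = h (ord a).
  by move=> ak; rewrite hE; [rewrite /rotate (negPf (ordS a ak)) | case: (oo a ak)].
have ordy a : a < k -> ord a <> y.
  by move=> /oo[_ +] e; rewrite e; lia.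
split.
- split=> [i ni|i j ni nj]; first by rewrite hE //; apply: (proj1 hok); apply: rn.
  rewrite !hE // => /(proj2 hok) e; apply: (rotate_inj p0 yp).
  by apply: e; apply: rn.
- move=> i j ni nj; have := ef i (rotate n f y j) ni (rn j nj); rewrite -hE //.
  by apply: ef1_mono => //; have := better i ni; lra.
- by move=> i ni; rewrite dE //; case: eqP => // _; apply: dn.
- move=> a; rewrite ltnS leq_eqVlt => /predU1P[->|ak].
    by rewrite ordk dE // eqxx.
  rewrite ordE //; have [na da] := oo a ak; split=> //; rewrite dE //.
  by case: eqP.
- move=> i ni; rewrite dE //; case: eqP => [-> _|_ /(onto i ni)[a ak <-]].
    by exists k.
  by exists a; [apply: ltnW | apply: ordE].
- move=> a b; rewrite !ltnS [a <= k]leq_eqVlt [b <= k]leq_eqVlt.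
  case/predU1P=> [->|ak]; case/predU1P=> [->|bk] //; rewrite ?ordk ?ordE //.
  + by move=> /esym /ordy; case.
  + by move=> /ordy; case.
  + exact: oI.
- move=> a j; rewrite ltnS leq_eqVlt => /predU1P[->|ak] nj.
    case=> [/(dS j nj) dj|[b]]; last by lia.
    rewrite ordk (hE j) // (hE y) // [in leRHS]/rotate (orbit_start p0 yp).
    by case: (ff y ny) => _ _; apply; [apply: rn | apply: rS].
  rewrite ordE // hord // => H.
  have [/rS dr|dj] := boolP (done j <= c).
    by rewrite hE //; apply: ne (rn j nj) _ => //; left; apply: dr.
  case: H => [/(dS j nj)|[b [ab]]]; first by rewrite (negPf dj).
  case: (ltngtP b k) => [bk||->]; last 2 first.
  + by lia.
  + by rewrite ordk => e; rewrite -e dy in dj.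
  rewrite ordE // => <-; rewrite hord //; apply: ne => //.
    by case: (oo b bk).
  by right; exists b; split=> //; lia.
Qed.

End Trading.

Section Picking.
Variables (c : nat) (lab h p : nat -> nat).
Hypotheses (v0 : forall i x, i < n -> x < m -> (0 <= v i x)%R).
Hypotheses (hok : hold_ok h) (pn : forall a, a < n -> p a < n).
Hypotheses (pI : inj_below n p).

Definition bundles_ok W bun : Prop := [/\
  (forall x, x < m -> bun x <= n),
  (forall x y, x < m -> y < m -> bun x != 0 -> lab x = lab y ->
     bun x = bun y -> x = y) &
  (forall i b, i < n -> 0 < b -> W i b = (\sum_(x < m | bun x == b) v i x)%R)].

Definition unassigned bun := [set x : 'I_m | (lab x == c) && (bun x == 0)].

(* p lists the agents in picking order, and the first k of them have picked in
   component c.  The field picking_ef1_free leaves room for the item that an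
   agent still to pick may add to her bundle. *)
Record picking k W bun : Prop := Picking {
  picking_ok : bundles_ok W bun;
  picking_old : forall x, x < m -> lab x < c -> bun x != 0;
  picking_new : forall x, x < m -> c < lab x -> bun x = 0;
  picking_taken : forall x, x < m -> lab x = c -> bun x != 0 ->
    exists2 a, a < k & bun x = h (p a);
  picking_free : #|unassigned bun| <= n - k;
  picking_ef1 : forall a b, a < n -> b < n ->
    ef1 (v (p a)) bun (h (p b)) (W (p a) (h (p a))) (W (p a) (h (p b)));
  picking_ef1_free : forall a b z, a < k -> k <= b -> b < n -> z < m ->
    lab z = c -> bun z = 0 ->
    ef1 (v (p a)) bun (h (p b)) (W (p a) (h (p a)))
      (W (p a) (h (p b)) + v (p a) z);
  picking_noenvy : forall a b, k <= b -> b < a -> a < n ->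
    (W (p a) (h (p b)) <= W (p a) (h (p a)))%R }.

Lemma picking_skip k W bun : k < n -> picking k W bun ->
  (forall z, z < m -> lab z = c -> bun z <> 0) -> picking k.+1 W bun.
Proof.
move=> kn [ok old new taken fr ef efz ne] none; split=> //.
- by move=> x xm lx bx; case: (taken x xm lx bx) => a ak; exists a => //; apply: ltnW.
- rewrite (_ : unassigned bun = set0) ?cards0 //; apply/setP => x; rewrite !inE.
  by apply/negP => /andP[/eqP /none H /eqP]; apply: H.
- by move=> a b z _ _ _ zm lz /none; case.
- by move=> a b kb; apply: ne; apply: ltnW.
Qed.

Lemma picking_pick k W bun z W' bun' : k < n -> picking k W bun ->
  z < m -> lab z = c -> bun z = 0 ->
  (forall x, x < m -> lab x = c -> bun x = 0 -> (v (p k) x <= v (p k) z)%R) ->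
  (forall x, x < m -> bun' x = if x == z then h (p k) else bun x) ->
  (forall i b, i < n ->
     W' i b = if b == h (p k) then (W i b + v i z)%R else W i b) ->
  picking k.+1 W' bun'.
Proof.
move=> kn [[bn bI Ws] old new taken fr ef efz ne] zm lz bz best bE WE.
have h0 i : i < n -> 0 < h (p i) by move=> /pn /(proj1 hok) /andP[].
have hE a b : a < n -> b < n -> (h (p a) == h (p b)) = (a == b).
  move=> na nb; apply/eqP/eqP => [|-> //] /(proj2 hok) e.
  by apply: pI => //; apply: e; apply: pn.
have WE' i a : i < n -> a < n -> W' i (h (p a)) =
    if a == k then (W i (h (p k)) + v i z)%R else W i (h (p a)).
  by move=> ni na; rewrite WE // hE //; case: eqP => [->|].
have keep b x : b < n -> x < m -> bun x = h (p b) -> bun' x = h (p b).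
  move=> nb xm xb; rewrite bE //; case: (x =P z) => // e.
  by move: (h0 b nb); rewrite -xb e bz.
have vz i : i < n -> (0 <= v i z)%R by move=> ni; apply: v0.
have fresh x : x < m -> lab x = c -> bun x <> h (p k).
  move=> xm lx e; have [|a ak] := taken x xm lx; first by rewrite e -lt0n h0.
  rewrite e => /eqP; rewrite hE //; last exact: ltn_trans ak kn.
  by rewrite eq_sym (ltn_eqF ak).
split.
- split=> [x xm|x y xm ym|i b ni b0].
  + rewrite bE //; case: (x =P z) => _; last exact: bn.
    by case/andP: (proj1 hok _ (pn kn)).
  + rewrite !bE //; case: (x =P z) => [->|_]; case: (y =P z) => [->|_] //.
    * by move=> _ lxy e; case: (fresh y ym _ (esym e)); rewrite -lxy.
    * by move=> _ lxz e; case: (fresh x xm _ e); rewrite lxz.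
    * exact: bI.
  + have zb : (bun z == b) = false by rewrite bz; apply/eqP; lia.
    rewrite WE //; case: eqP => [e|/eqP ne'].
      rewrite [RHS](bigD1 (Ordinal zm)) /= ?bE ?eqxx ?e // addrC Ws ?h0 //.
      apply: (congr1 (fun r => r + v i z)%R); rewrite -e; apply: eq_bigl => x; rewrite bE // -val_eqE /=.
      by have [->|] := eqVneq (x : nat) z; rewrite ?zb ?andbF // andbT.
    rewrite Ws //; apply: eq_bigl => x; rewrite bE //.
    by have [->|] := eqVneq (x : nat) z; rewrite ?zb // eq_sym (negPf ne').
- move=> x xm lx; rewrite bE //; case: (x =P z) => _; last exact: old.
  by rewrite -lt0n h0.
- move=> x xm lx; rewrite bE //; case: (x =P z) => [e|_]; last exact: new.
  by move: lx; rewrite e lz ltnn.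
- move=> x xm lx; rewrite bE //; case: (x =P z) => _; first by exists k.
  by move=> /(taken x xm lx)[a ak]; exists a => //; apply: ltnW.
- have -> : unassigned bun' = unassigned bun :\ Ordinal zm.
    apply/setP => x; rewrite !inE bE // -val_eqE /=.
    by have [->|] := eqVneq (x : nat) z; rewrite // (gtn_eqF (h0 k kn)) andbF.
  have := cardsD1 (Ordinal zm) (unassigned bun).
  have -> : Ordinal zm \in unassigned bun by rewrite inE /= lz bz !eqxx.
  by move: fr kn; lia.
- move=> a b na nb; rewrite !WE' ?pn //.
  have keepE x : x < m -> bun x = h (p b) -> bun' x = h (p b) by apply: keep.
  have va := vz _ (pn na); case: (b =P k) => [bk|_].
    have [->|ak] := eqVneq a k; first by rewrite bk; left.
    have [lt|] := ltnP a k.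
      rewrite bk; have := efz a k z lt (leqnn k) kn zm lz bz.
      by rewrite -bk; apply: ef1_mono.
    rewrite leq_eqVlt eq_sym (negPf ak) /= => ka.
    right; exists z; split=> //; first by rewrite bE // eqxx bk.
    by have := ne a k (leqnn k) ka na; lra.
  by have := ef a b na nb; apply: ef1_mono => //; have := vz _ (pn kn); case: eqP => [->|] *; lra.
- move=> a b x ak kb nb xm lx; rewrite bE //; case: (x =P z) => [_|_ bx].
    by have := h0 k kn; lia.
  have na : a < n by lia.
  have keepE y : y < m -> bun y = h (p b) -> bun' y = h (p b) by apply: keep.
  rewrite !WE' ?pn // (gtn_eqF kb); case: (a =P k) => [e|/eqP nak].
    have := ef a b na nb; apply: ef1_mono => //; rewrite e.
    by have := best x xm lx bx; lra.
  have ak' : a < k by rewrite ltn_neqAle nak.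
  by have := efz a b x ak' (ltnW kb) nb xm lx bx; apply: ef1_mono.
- move=> a b kb ba na; rewrite !WE' ?pn //; try lia.
  by rewrite (gtn_eqF kb) (gtn_eqF (ltn_trans kb ba)); apply: ne => //; lia.
Qed.

End Picking.
End FairDivision.

(** * The algorithm and its correctness *)

(* Natural arrays: 4 is the bundle 1, ..., n held by an agent, 5 the component
   label of an item, 6 the bundle of an item (0 if it is not yet allocated),
   7 the agent holding one's favourite bundle, 8 the next value of array 4,
   9 exceeds the current component c exactly for the agents removed in its
   trading phase, 10 the order of removal.  Natural scalars: 11 and 12 walk
   along a trading cycle, 13 is the picking agent, 14 one plus the best item
   found (0 if none), 15 and 16 are labels to be merged, 20 to 23 are loop
   counters, 20 being the current component.  Real array 1 holds the value of
   every bundle for every agent. *)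
Definition arr a i := NGet a i (NConst 0).
Definition nset0 a e := PN a (NConst 0) (NConst 0) e.
Definition arrset a i e := PN a i (NConst 0) e.
Definition NLt e1 e2 := TNot (NLe e2 e1).
Definition NEq e1 e2 := TAnd (NLe e1 e2) (NLe e2 e1).
Definition RLt e1 e2 := TNot (RLe e2 e1).
Definition NSucc e := NAdd e (NConst 1).

Section ProgramSpecs.
Variable R : realType.
Implicit Types s : state R.

Lemma teval_NLt s e1 e2 : teval s (NLt e1 e2) = (neval s e1 < neval s e2).
Proof. by rewrite /= ltnNge. Qed.

Lemma teval_NEq s e1 e2 : teval s (NEq e1 e2) = (neval s e1 == neval s e2).
Proof. by rewrite /= eqn_leq. Qed.

Lemma teval_RLt s e1 e2 : teval s (RLt e1 e2) = (reval s e1 < reval s e2)%R.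
Proof. by rewrite /= -ltNge. Qed.

Lemma sem_PIf b p s : sem (PIf b p) s = if teval s b then sem p s else s.
Proof. by []. Qed.

Lemma sem_nset0 a e s : sem (nset0 a e) s = nset s a 0 0 (neval s e).
Proof. by []. Qed.

Lemma sem_arrset a i e s :
  sem (arrset a i e) s = nset s a (neval s i) 0 (neval s e).
Proof. by []. Qed.

Lemma nmem_arr s a i k i' :
  nmem (nset s a i 0 k) a i' 0 = if i' == i then k else nmem s a i' 0.
Proof. by rewrite /nmem /nset /update !eqxx andbT. Qed.

Lemma rmem_nset s a i j k : rmem (nset s a i j k) = rmem s.
Proof. by []. Qed.

Lemma nmem_loop s a k d : d != a -> nmem (nset s a 0 0 k) d = nmem s d.
Proof. exact: nmem_nset. Qed.

Definition init_hold := PFor 0 22 (arrset 4 (var 22) (NSucc (var 22))).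

Lemma init_holdP s i : i < nmem s 0 0 0 -> nmem (sem init_hold s) 4 i 0 = i.+1.
Proof.
have := @sem_PFor R (fun k s1 => forall i, i < k -> nmem s1 4 i 0 = i.+1)
  0 22 (arrset 4 (var 22) (NSucc (var 22))) s isT isT.
apply=> // k s1 kn ek _ _ IH {}i; rewrite ltnS sem_arrset /= ek nmem_loop //.
by rewrite nmem_arr addn1; case: eqP => [->//|ik lik]; apply: IH; lia.
Qed.

Definition init_label := PFor 1 23 (arrset 5 (var 23) (var 23)).

Lemma init_labelP s x : x < nmem s 1 0 0 -> nmem (sem init_label s) 5 x 0 = x.
Proof.
have := @sem_PFor R (fun k s1 => forall x, x < k -> nmem s1 5 x 0 = x)
  1 23 (arrset 5 (var 23) (var 23)) s isT isT.
apply=> // k s1 kn ek _ _ IH {}x; rewrite ltnS sem_arrset /= ek nmem_loop //.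
by rewrite nmem_arr; case: eqP => [->//|ik lik]; apply: IH; lia.
Qed.

Definition relabel :=
  PFor 1 22 (PIf (NEq (arr 5 (var 22)) (var 15)) (arrset 5 (var 22) (var 16))).

Lemma relabelP s x : x < nmem s 1 0 0 -> nmem (sem relabel s) 5 x 0 =
  if nmem s 5 x 0 == nmem s 15 0 0 then nmem s 16 0 0 else nmem s 5 x 0.
Proof.
rewrite /relabel; set b := PIf _ _.
suff: forall x, nmem (sem (PFor 1 22 b) s) 5 x 0 =
    if (x < nmem s 1 0 0) && (nmem s 5 x 0 == nmem s 15 0 0)
    then nmem s 16 0 0 else nmem s 5 x 0.
  by move=> -> ->.
have := @sem_PFor R (fun k s1 => forall x, nmem s1 5 x 0 =
    if (x < k) && (nmem s 5 x 0 == nmem s 15 0 0)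
    then nmem s 16 0 0 else nmem s 5 x 0) 1 22 b s isT isT.
apply=> // k s1 kn ek fn _ IH {}x.
rewrite nmem_loop // /b sem_PIf teval_NEq sem_arrset /= ek (fn 15) // (fn 16) //.
rewrite IH ltnn /= ltnS leq_eqVlt; case: eqP => e.
  rewrite nmem_arr IH; case: eqP => [->|_]; last by [].
  by rewrite e eqxx.
by rewrite IH; case: (x =P k) => [->|]//=; rewrite ltnn; case: eqP.
Qed.

Definition merge :=
  PSeq (nset0 15 (arr 5 (var 20))) (PSeq (nset0 16 (arr 5 (var 21))) relabel).

Lemma mergeP s x : x < nmem s 1 0 0 -> nmem (sem merge s) 5 x 0 =
  if nmem s 5 x 0 == nmem s 5 (nmem s 20 0 0) 0
  then nmem s 5 (nmem s 21 0 0) 0 else nmem s 5 x 0.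
Proof.
move=> xm; rewrite !sem_PSeq !sem_nset0 relabelP //.
Qed.

Definition label_edge :=
  PIf (NEq (NGet 2 (var 20) (var 21)) (NConst 1)) merge.

Definition label := PFor 1 20 (PFor 1 21 label_edge).

Lemma labelP s (conn : nat -> nat -> Prop) :
  let m := nmem s 1 0 0 in
  (forall x, conn x x) -> (forall x y, conn x y -> conn y x) ->
  (forall x y z, conn x y -> conn y z -> conn x z) ->
  (forall x y, x < m -> y < m -> nmem s 2 x y = 1 -> conn x y) ->
  (forall x, x < m -> nmem s 5 x 0 = x) ->
  let l x := nmem (sem label s) 5 x 0 in
  [/\ forall x, x < m -> l x < m,
      forall x y, x < m -> y < m -> l x = l y -> conn x y &
      forall x y, x < m -> y < m -> nmem s 2 x y = 1 -> l x = l y].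
Proof.
move=> m cr cs ct ce l0 /=.
pose J (P : nat -> nat -> Prop) s1 := [/\ forall x, x < m -> nmem s1 5 x 0 < m,
      forall x y, x < m -> y < m -> nmem s1 5 x 0 = nmem s1 5 y 0 -> conn x y &
      forall x y, x < m -> y < m -> P x y -> nmem s 2 x y = 1 ->
        nmem s1 5 x 0 = nmem s1 5 y 0].
suff: J (fun x y => x < m) (sem label s).
  by case=> j1 j2 j3; split=> // x y xm ym; apply: j3.
have := @sem_PFor R (fun k => J (fun x y => x < k)) 1 20 (PFor 1 21 label_edge)
  s isT isT.
apply.
  by split=> [x xm|x y xm ym|//]; rewrite nmem_loop // !l0 // => ->.
move=> k s1 km ek fn fr J1.
have m1 : nmem s1 1 0 0 = m by rewrite (fn 1 isT).
suff: J (fun x y => x < k \/ x = k /\ y < m) (sem (PFor 1 21 label_edge) s1).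
  case=> j1 j2 j3; split=> [x xm|x y xm ym|x y xm ym xk]; rewrite ?nmem_loop //.
  - exact: j1.
  - exact: j2.
  - by apply: j3 => //; lia.
rewrite -m1; have := @sem_PFor R (fun k' s2 => J (fun x y => x < k \/ x = k /\ y < k') s2)
  1 21 label_edge s1 isT isT.
apply; first by split; case: J1 => // j1 j2 j3 x y xm ym [xk|[_]] //; apply: j3.
move=> k' s2 km' ek' fn' fr' [j1 j2 j3]; rewrite m1 in km'.
have e20 : nmem s2 20 0 0 = k by rewrite (fn' 20 isT).
rewrite /label_edge sem_PIf teval_NEq /= ek' e20 (fn' 2 isT) (fn 2 isT).
case: eqP => e; last first.
  split=> [x xm|x y xm ym|x y xm ym xk]; rewrite ?nmem_loop //.
  - exact: j1.
  - exact: j2.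
  - move=> exy; apply: j3 => //; case: xk => [|[xe]]; first by left.
    rewrite ltnS leq_eqVlt => /predU1P[ye|]; last by right.
    by case: e; rewrite -xe -ye.
have mE x : x < m -> nmem (sem merge s2) 5 x 0 =
    if nmem s2 5 x 0 == nmem s2 5 k 0 then nmem s2 5 k' 0 else nmem s2 5 x 0.
  by move=> xm; rewrite mergeP ?ek' ?e20 // (fn' 1 isT) m1.
split=> [x xm|x y xm ym|x y xm ym xk]; rewrite ?nmem_loop // ?mE //.
- by case: ifP => _; apply: j1.
- have ckk : conn k k' by apply: ce.
  case: eqP => [/(j2 _ _ xm km) cx|_]; case: eqP => [/(j2 _ _ ym km) cy|_].
  + by move=> _; apply: ct cx (cs _ _ cy).
  + by move=> /(j2 _ _ km' ym); apply: ct (ct _ _ _ cx ckk).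
  + by move=> /(j2 _ _ xm km') cx; apply: ct cx (cs _ _ (ct _ _ _ cy ckk)).
  + exact: j2.
- move=> exy; have [[xe ye]|ne] : (x = k /\ y = k') \/ ~ (x = k /\ y = k') by lia.
    by rewrite xe ye eqxx; case: ifP.
  by rewrite (j3 x y) //; lia.
Qed.

End ProgramSpecs.

Section Trade.
Variable R : realType.
Implicit Types s : state R.

Definition improve :=
  PIf (TAnd (NLe (arr 9 (var 23)) (var 20))
            (RLt (RGet 1 (var 22) (arr 4 (arr 7 (var 22))))
                 (RGet 1 (var 22) (arr 4 (var 23)))))
      (arrset 7 (var 22) (var 23)).

Definition favourite_row :=
  PSeq (arrset 7 (var 22) (var 22))
    (PSeq (arrset 8 (var 22) (arr 4 (var 22))) (PFor 0 23 improve)).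

Definition favourite := PFor 0 22 favourite_row.

Definition is_favourite s n i f :=
  let c := nmem s 20 0 0 in let W := rmem s 1 i in
  [/\ f = i \/ (f < nmem s 0 0 0 /\ nmem s 9 f 0 <= c),
      (W (nmem s 4 i 0) <= W (nmem s 4 f 0))%R
    & forall j, j < n -> nmem s 9 j 0 <= c ->
        (W (nmem s 4 j 0) <= W (nmem s 4 f 0))%R].

Lemma favourite_rowP s : let n := nmem s 0 0 0 in let i := nmem s 22 0 0 in
  let s' := sem favourite_row s in
  [/\ is_favourite s n i (nmem s' 7 i 0), nmem s' 8 i 0 = nmem s 4 i 0,
      forall i', i' != i -> nmem s' 7 i' 0 = nmem s 7 i' 0 &
      forall i', i' != i -> nmem s' 8 i' 0 = nmem s 8 i' 0].
Proof.
move=> n i /=; rewrite /favourite_row !sem_PSeq !sem_arrset /=.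
set s0 := nset _ 8 _ _ _.
have s0E d : d \notin [:: 7; 8] -> nmem s0 d = nmem s d.
  by rewrite !inE negb_or => /andP[? ?]; rewrite !nmem_nset.
have {}s0E : [/\ nmem s0 0 = nmem s 0, nmem s0 4 = nmem s 4, nmem s0 9 = nmem s 9,
    nmem s0 20 = nmem s 20 & nmem s0 22 = nmem s 22] by rewrite !s0E.
case: s0E => s00 s04 s09 s020 s022.
have s08 i' : nmem s0 8 i' 0 = if i' == i then nmem s 4 i 0 else nmem s 8 i' 0.
  by rewrite /s0 nmem_arr !(@nmem_nset _ _ 7).
have s07 i' : nmem s0 7 i' 0 = if i' == i then i else nmem s 7 i' 0.
  by rewrite /s0 nmem_nset // nmem_arr.
suff: is_favourite s n i (nmem (sem (PFor 0 23 improve) s0) 7 i 0) /\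
    forall i', i' != i -> nmem (sem (PFor 0 23 improve) s0) 7 i' 0 = nmem s 7 i' 0.
  case=> H H'; split=> // [|i' ne]; rewrite nmem_sem // s08 ?eqxx //.
  by rewrite (negPf ne).
have e0 : n = nmem s0 0 0 0 by rewrite s00.
rewrite {1}e0; have := @sem_PFor R (fun k s1 => is_favourite s k i (nmem s1 7 i 0) /\
    forall i', i' != i -> nmem s1 7 i' 0 = nmem s 7 i' 0) 0 23 improve s0 isT isT.
apply.
  rewrite nmem_loop // s07 eqxx; split=> [|i' ne].
    by split=> //; left.
  by rewrite s07 (negPf ne).
move=> k s1 kn ek fn fr [[f1 f2 f3] f4].
rewrite nmem_loop // sem_PIf.
have -> : forall b c, teval s1 (TAnd b c) = teval s1 b && teval s1 c by [].
rewrite teval_RLt /= ek (fn 9) // (fn 20) // (fn 22) // (fn 4) // (fr 1) //.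
rewrite s09 s020 s022 s04 rmem_nset -/i.
case: andP => [[d1 d2]|/andP H].
  rewrite sem_arrset /= ek (fn 22) // s022 -/i; split=> [|i' ne].
    rewrite nmem_arr eqxx; split=> [||j].
    - by right; rewrite -s00.
    - by apply: ltW; apply: le_lt_trans d2.
    - rewrite ltnS leq_eqVlt => /predU1P[->|jk] dj //.
      by apply: ltW; apply: le_lt_trans d2; apply: f3.
  by rewrite nmem_arr (negPf ne) f4.
split=> //; split=> // j; rewrite ltnS leq_eqVlt => /predU1P[->|jk] dj.
  by move: H; rewrite dj /= -leNgt.
exact: f3.
Qed.

Lemma favouriteP s i : i < nmem s 0 0 0 ->
  is_favourite s (nmem s 0 0 0) i (nmem (sem favourite s) 7 i 0) /\
  nmem (sem favourite s) 8 i 0 = nmem s 4 i 0.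
Proof.
have := @sem_PFor R (fun k s1 => forall i, i < k ->
    is_favourite s (nmem s 0 0 0) i (nmem s1 7 i 0) /\
    nmem s1 8 i 0 = nmem s 4 i 0) 0 22 favourite_row s isT isT.
apply=> // k s1 kn ek fn fr IH {}i.
rewrite !nmem_loop // ltnS leq_eqVlt.
have [] := favourite_rowP s1; rewrite ek /is_favourite (fn 4) // (fn 9) //.
rewrite (fn 20) // (fn 0) // (fr 1) // => H1 H2 H3 H4 /predU1P[-> //|ik].
by rewrite H3 ?H4 ?ltn_eqF //; apply: IH.
Qed.

Definition start :=
  PFor 0 22 (PIf (NLe (arr 9 (var 22)) (var 20)) (nset0 11 (var 22))).

Lemma startP s : let n := nmem s 0 0 0 in
  (exists2 i, i < n & nmem s 9 i 0 <= nmem s 20 0 0) ->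
  let x := nmem (sem start s) 11 0 0 in x < n /\ nmem s 9 x 0 <= nmem s 20 0 0.
Proof.
move=> n [i ni di] /=; move: (ni).
have := @sem_PFor R (fun k s1 => i < k -> let x := nmem s1 11 0 0 in
    x < n /\ nmem s 9 x 0 <= nmem s 20 0 0) 0 22
  (PIf (NLe (arr 9 (var 22)) (var 20)) (nset0 11 (var 22))) s isT isT.
apply=> // k s1 kn ek fn fr IH; rewrite nmem_loop // ltnS leq_eqVlt sem_PIf /=.
rewrite (fn 9) // (fn 20) // ek; case: ifP => [dk _|dk].
  by rewrite sem_nset0 nget_nset /= ek.
case/predU1P => [e|]; last exact: IH.
by rewrite -e di in dk.
Qed.

(* After n steps along the favourites the agent in scalar 11 lies on a cycle. *)
Definition walk := PFor 0 22 (nset0 11 (arr 7 (var 11))).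

Lemma walkP s : nmem (sem walk s) 11 0 0 =
  iter (nmem s 0 0 0) (fun i => nmem s 7 i 0) (nmem s 11 0 0).
Proof.
have := @sem_PFor R (fun k s1 => nmem s1 11 0 0 =
    iter k (fun i => nmem s 7 i 0) (nmem s 11 0 0)) 0 22
  (nset0 11 (arr 7 (var 11))) s isT isT.
apply=> [|k s1 kn ek fn fr IH]; first by rewrite nmem_loop.
by rewrite nmem_loop // sem_nset0 nget_nset iterS -IH /= (fn 7).
Qed.

Definition shift_step :=
  PSeq (arrset 8 (var 12) (arr 4 (arr 7 (var 12)))) (nset0 12 (arr 7 (var 12))).

Definition shift := PSeq (nset0 12 (var 11)) (PFor 0 22 shift_step).

Lemma shiftP s i : (forall i, i < nmem s 0 0 0 -> nmem s 8 i 0 = nmem s 4 i 0) ->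
  i < nmem s 0 0 0 -> nmem (sem shift s) 8 i 0 =
  nmem s 4 (rotate (nmem s 0 0 0) (fun i => nmem s 7 i 0) (nmem s 11 0 0) i) 0.
Proof.
move=> e8 ni; set f := fun i => _; set y := nmem s 11 0 0.
rewrite /shift sem_PSeq sem_nset0 /=; set s0 := nset _ _ _ _ _.
suff: nmem (sem (PFor 0 22 shift_step) s0) 8 i 0 =
      nmem s 4 (rotate (nmem s 0 0 0) f y i) 0 /\
      nmem (sem (PFor 0 22 shift_step) s0) 12 0 0 = iter (nmem s 0 0 0) f y by case.
have := @sem_PFor R (fun k s1 => nmem s1 8 i 0 = nmem s 4 (rotate k f y i) 0 /\
    nmem s1 12 0 0 = iter k f y) 0 22 shift_step s0 isT isT.
have -> : nmem s0 0 0 0 = nmem s 0 0 0 by rewrite nmem_nset.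
apply.
  split; first by rewrite nmem_loop // nmem_loop // e8.
  by rewrite nmem_loop // nget_nset.
move=> k s1 kn ek fn fr [IH1 IH2]; rewrite !(@nmem_loop _ _ 22) //.
rewrite /shift_step sem_PSeq sem_arrset sem_nset0 /= nget_nset.
rewrite nmem_nset // nmem_arr !nmem_nset // IH1 IH2.
rewrite (fn 7) // (fn 4) // {1 2 3}/s0 !(@nmem_nset _ _ 12) //; split=> //.
rewrite /rotate trajectSr mem_rcons inE.
by have [->|] := eqVneq i (iter k f y).
Qed.

Definition adopt := PFor 0 22 (arrset 4 (var 22) (arr 8 (var 22))).

Lemma adoptP s i : i < nmem s 0 0 0 -> nmem (sem adopt s) 4 i 0 = nmem s 8 i 0.
Proof.
have := @sem_PFor R (fun k s1 => forall i, i < k -> nmem s1 4 i 0 = nmem s 8 i 0)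
  0 22 (arrset 4 (var 22) (arr 8 (var 22))) s isT isT.
apply=> // k s1 kn ek fn fr IH {}i; rewrite nmem_loop // sem_arrset /= ek.
rewrite (fn 8) // nmem_arr ltnS leq_eqVlt => /predU1P[->|ik]; first by rewrite eqxx.
by rewrite ltn_eqF // IH.
Qed.

Definition trade_step :=
  PSeq favourite (PSeq start (PSeq walk (PSeq shift (PSeq adopt
    (PSeq (arrset 9 (var 11) (NSucc (var 20))) (arrset 10 (var 21) (var 11))))))).

Definition trade := PFor 0 21 trade_step.

Definition trading_st m (v : nat -> nat -> R) k s := trading (nmem s 0 0 0) m v (nmem s 20 0 0) (rmem s 1)
  ((nmem s 6)^~ 0) k ((nmem s 4)^~ 0) ((nmem s 9)^~ 0) ((nmem s 10)^~ 0).

Lemma trade_stepP m v s : let k := nmem s 21 0 0 in k < nmem s 0 0 0 ->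
  trading_st m v k s -> trading_st m v k.+1 (sem trade_step s).
Proof.
move=> k kn T; have [i ni di] := trading_left T kn.
set n := nmem s 0 0 0 in kn ni; set c := nmem s 20 0 0 in di.
rewrite /trade_step !sem_PSeq.
set s1 := sem favourite s; set s2 := sem start s1; set s3 := sem walk s2.
set s4 := sem shift s3; set s5 := sem adopt s4.
rewrite !sem_arrset /=.
have E1 d : d \notin [:: 22; 23; 7; 8] -> nmem s1 d = nmem s d.
  by move=> dn; apply: nmem_sem; apply: contra dn; rewrite !inE; lia.
have E2 d : d \notin [:: 22; 11] -> nmem s2 d = nmem s1 d by move=> dn; rewrite nmem_sem.
have E3 d : d \notin [:: 22; 11] -> nmem s3 d = nmem s2 d by move=> dn; rewrite nmem_sem.
have E4 d : d \notin [:: 12; 22; 8; 12] -> nmem s4 d = nmem s3 d by move=> dn; rewrite nmem_sem.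
have E5 d : d \notin [:: 22; 4] -> nmem s5 d = nmem s4 d by move=> dn; rewrite nmem_sem.
have r5 : rmem s5 = rmem s.
  by apply: funext => d; rewrite !rmem_sem.
have [nx dx] : nmem s2 11 0 0 < n /\ nmem s 9 (nmem s2 11 0 0) 0 <= c.
  by have := @startP s1; rewrite !E1 //; apply; exists i.
set x := nmem s2 11 0 0 in nx dx.
pose f := (nmem s1 7)^~ 0.
have y3 : nmem s3 11 0 0 = iter n f x.
  by rewrite walkP (E2 0) // (E2 7) // (E1 0).
have y5 : nmem s5 11 0 0 = iter n f x by rewrite E5 // E4.
have h5 j : j < n -> nmem s5 4 j 0 = nmem s 4 (rotate n f (iter n f x) j) 0.
  move=> nj; have n4 : nmem s4 0 0 0 = n by rewrite E4 // E3 // E2 // E1.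
  rewrite adoptP ?n4 // shiftP.
  - by rewrite y3 E3 // E2 // E1 // E3 // E2 // E3 // E2 // E1.
  - move=> j'; rewrite E3 // E2 // E1 // => nj'.
    by rewrite !E3 // !E2 // [nmem s1 4]E1 //; case: (favouriteP nj').
  - by rewrite E3 // E2 // E1.
rewrite /trading_st; set s' := nset _ 10 _ _ _.
have E' d : d \notin [:: 9; 10; 4; 22; 23; 7; 8; 11; 12] -> nmem s' d = nmem s d.
  rewrite !inE => H; rewrite !nmem_nset; try lia.
  by rewrite E5 ?E4 ?E3 ?E2 ?E1 // ?inE; lia.
rewrite (E' 0) // (E' 20) // (E' 6) // !rmem_nset r5 -/n -/c.
apply: (trading_step (x := x) (f := f) T) => //.
- by move=> j nj; have [] := favouriteP nj.
- move=> j nj; rewrite nmem_nset // nmem_arr y5 E5 // E4 // E3 // E2 // E1 //.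
  by rewrite E5 // E4 // E3 // E2 // E1 // addn1.
- move=> a an; rewrite nmem_arr !(@nmem_nset _ _ 9) // y5.
  by do 2![rewrite E5 // E4 // E3 // E2 // E1 //].
Qed.

Lemma tradeP m v s : trading_st m v 0 s ->
  trading_st m v (nmem s 0 0 0) (sem trade s).
Proof.
move=> T; have := @sem_PFor R (fun k s1 => trading_st m v k s1) 0 21 trade_step
  s isT isT.
apply.
  by rewrite /trading_st !nmem_loop.
move=> k s1 kn ek fn fr IH; rewrite /trading_st !nmem_loop //.
by have := @trade_stepP m v s1; rewrite ek (fn 0) //; apply.
Qed.

End Trade.

Section Pick.
Variable R : realType.
Implicit Types s : state R.

Lemma rmem_cell s a i j r i' j' : rmem (rset s a i j r) a i' j' =
  if (i' == i) && (j' == j) then r else rmem s a i' j'.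
Proof. by rewrite /rmem /rset /update eqxx. Qed.

Definition cand_item := NSub (var 14) (NConst 1).

Definition try_item :=
  PIf (TAnd (NEq (arr 5 (var 22)) (var 20))
        (TAnd (NEq (arr 6 (var 22)) (NConst 0))
           (TNot (TAnd (NLt (NConst 0) (var 14))
              (RLe (RGet 0 (var 13) (var 22)) (RGet 0 (var 13) cand_item))))))
      (nset0 14 (NSucc (var 22))).

Definition best := PFor 1 22 try_item.

Lemma bestP s : nmem s 14 0 0 = 0 ->
  let m := nmem s 1 0 0 in let v := rmem s 0 (nmem s 13 0 0) in
  let available x := nmem s 5 x 0 = nmem s 20 0 0 /\ nmem s 6 x 0 = 0 in
  let cand := nmem (sem best s) 14 0 0 in
  cand = 0 /\ (forall x, x < m -> ~ available x) \/
  exists z, [/\ cand = z.+1, z < m, available z &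
    forall x, x < m -> available x -> (v x <= v z)%R].
Proof.
move=> c0 m v available /=.
have := @sem_PFor R (fun k s1 => let cand := nmem s1 14 0 0 in
  cand = 0 /\ (forall x, x < k -> ~ available x) \/
  exists z, [/\ cand = z.+1, z < m, available z &
    forall x, x < k -> available x -> (v x <= v z)%R]) 1 22 try_item s isT isT.
apply; first by left; rewrite nmem_loop.
move=> k s1 km ek fn fr IH; rewrite nmem_loop // sem_PIf.
have tA b d : teval s1 (TAnd b d) = teval s1 b && teval s1 d by [].
have tN b : teval s1 (TNot b) = ~~ teval s1 b by [].
rewrite !(tA, tN, teval_NEq, teval_NLt) sem_nset0 /= ek.
rewrite (fn 5) // (fn 6) // (fn 20) // (fn 13) // (fr 0) // -/v.
have avE : (nmem s 5 k 0 == nmem s 20 0 0) && (nmem s 6 k 0 == 0) <-> available k.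
  by split=> [/andP[/eqP ? /eqP ?]|[-> ->]]; [split | rewrite !eqxx].
rewrite andbA; case: andP => [[/avE ak better]|nb].
  rewrite nget_nset; right; exists k; split=> //; first by rewrite addn1.
  move=> x; rewrite ltnS leq_eqVlt => /predU1P[->//|xk] ax.
  case: IH => [[_ H]|[z [ez zm az zb]]]; first by case: (H x xk ax).
  move: better; rewrite ez /= subn1 /= -ltNge => /ltW; apply: le_trans.
  exact: zb.
case: IH => [[e0 H]|[z [ez zm az zb]]].
  left; split=> // x; rewrite ltnS leq_eqVlt => /predU1P[->|]; last exact: H.
  by move=> /avE ak; apply: nb; split=> //; rewrite e0.
right; exists z; split=> // x; rewrite ltnS leq_eqVlt => /predU1P[->|]; last exact: zb.
move=> /avE ak; apply: contraT => lt; case: nb; split=> //.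
by rewrite ez /= subn1 /= (negPf lt).
Qed.

Definition add_value :=
  PR 1 (var 22) (arr 4 (var 13))
    (RAdd (RGet 1 (var 22) (arr 4 (var 13))) (RGet 0 (var 22) cand_item)).

Lemma add_valueP s i b : i < nmem s 0 0 0 ->
  rmem (sem (PFor 0 22 add_value) s) 1 i b =
  if b == nmem s 4 (nmem s 13 0 0) 0
  then (rmem s 1 i b + rmem s 0 i (nmem s 14 0 0).-1)%R else rmem s 1 i b.
Proof.
move=> ni; suff: forall i, rmem (sem (PFor 0 22 add_value) s) 1 i b =
    if (i < nmem s 0 0 0) && (b == nmem s 4 (nmem s 13 0 0) 0)
    then (rmem s 1 i b + rmem s 0 i (nmem s 14 0 0).-1)%R else rmem s 1 i b.
  by move=> ->; rewrite ni.
have := @sem_PFor R (fun k s1 => forall i, rmem s1 1 i b =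
    if (i < k) && (b == nmem s 4 (nmem s 13 0 0) 0)
    then (rmem s 1 i b + rmem s 0 i (nmem s 14 0 0).-1)%R else rmem s 1 i b)
  0 22 add_value s isT isT.
apply=> // k s1 kn ek fn fr IH {ni}i; rewrite rmem_nset.
have -> : sem add_value s1 = rset s1 1 k (nmem s1 4 (nmem s1 13 0 0) 0)
   (rmem s1 1 k (nmem s1 4 (nmem s1 13 0 0) 0) + rmem s1 0 k (nmem s1 14 0 0 - 1))%R.
  by rewrite -ek.
rewrite (fn 4) // (fn 13) // (fn 14) // (fr 0) // rmem_cell subn1.
rewrite ltnS leq_eqVlt; have [->|] /= := eqVneq i k; last by rewrite IH.
by case: (b =P _) => [<-|_]; rewrite IH ltnn.
Qed.

Definition give :=
  PIf (NLt (NConst 0) (var 14))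
    (PSeq (arrset 6 cand_item (arr 4 (var 13))) (PFor 0 22 add_value)).

Definition pick_step :=
  PSeq (nset0 13 (arr 10 (NSub (NSub (var 0) (var 21)) (NConst 1))))
    (PSeq (nset0 14 (NConst 0)) (PSeq best give)).

Definition pick := PFor 0 21 pick_step.

Definition picker s a := nmem s 10 (nmem s 0 0 0 - a - 1) 0.

Definition picking_st k s :=
  picking (nmem s 0 0 0) (nmem s 1 0 0) (rmem s 0) (nmem s 20 0 0)
    ((nmem s 5)^~ 0) ((nmem s 4)^~ 0) (picker s) k (rmem s 1) ((nmem s 6)^~ 0).

Definition pick_ready s :=
  [/\ forall i x, i < nmem s 0 0 0 -> x < nmem s 1 0 0 -> (0 <= rmem s 0 i x)%R,
      hold_ok (nmem s 0 0 0) ((nmem s 4)^~ 0),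
      forall a, a < nmem s 0 0 0 -> picker s a < nmem s 0 0 0 &
      inj_below (nmem s 0 0 0) (picker s)].

Lemma pick_stepP s : let k := nmem s 21 0 0 in k < nmem s 0 0 0 ->
  pick_ready s -> picking_st k s -> picking_st k.+1 (sem pick_step s).
Proof.
move=> k kn [v0 hok pn pI] T.
rewrite /pick_step !sem_PSeq !sem_nset0 /=.
set s1 := nset (nset s _ _ _ _) _ _ _ _; set s2 := sem best s1.
have E1 d : d \notin [:: 13; 14] -> nmem s1 d = nmem s d.
  by rewrite !inE negb_or => /andP[? ?]; rewrite !nmem_nset.
have E2 d : d \notin [:: 22; 14] -> nmem s2 d = nmem s1 d.
  by move=> dn; rewrite nmem_sem.
have r2 : rmem s2 = rmem s by apply: funext => d; rewrite rmem_sem.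
have e13 : nmem s1 13 0 0 = picker s k by rewrite nmem_nset // nget_nset.
have e14 : nmem s1 14 0 0 = 0 by rewrite nget_nset.
have := bestP e14; rewrite -/s2 e13 !E1 // /= rmem_nset => B.
set s3 := sem give s2.
have E3 d : d \notin [:: 13; 14; 22; 6] -> nmem s3 d = nmem s d.
  rewrite !inE => H; rewrite nmem_sem ?E2 ?E1 // !inE; lia.
have r3 : rmem s3 0 = rmem s 0 by rewrite rmem_sem // r2.
rewrite /picking_st (_ : picker s3 = picker s); last first.
  by apply: funext => a; rewrite /picker !E3.
rewrite r3 !(E3 0, E3 1, E3 20, E3 5, E3 4) //.
case: B => [[c0 none]|[z [cz zm [lz bz] zbest]]].
  have -> : s3 = s2 by rewrite /s3 /give sem_PIf teval_NLt /= c0.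
  rewrite r2 (E2 6) // (E1 6) //; apply: picking_skip => // x xm lx bx.
  exact: (none x xm).
have e3 : s3 = sem (PFor 0 22 add_value) (nset s2 6 z 0 (nmem s 4 (picker s k) 0)).
  rewrite /s3 /give sem_PIf teval_NLt sem_PSeq sem_arrset /= cz /= subn1 /=.
  by rewrite !E2 // e13 E1.
apply: (picking_pick v0 hok pn pI kn T zm lz bz) => //.
- by move=> x xm lx bx; apply: zbest.
- by move=> x xm; rewrite e3 nmem_sem // nmem_arr E2 // E1.
- move=> i b ni; rewrite e3 add_valueP; last by rewrite nmem_nset // E2 // E1.
  by rewrite !rmem_nset r2 !nmem_nset // cz E2 // E1 // E2 // e13.
Qed.

Lemma pickP s : pick_ready s -> picking_st 0 s ->
  picking_st (nmem s 0 0 0) (sem pick s).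
Proof.
move=> ready T; have := @sem_PFor R (fun k s1 => picking_st k s1) 0 21 pick_step
  s isT isT.
have pE s1 k : picker (nset s1 21 0 0 k) = picker s1.
  by apply: funext => a; rewrite /picker !nmem_loop.
apply.
  by rewrite /picking_st pE !nmem_loop.
move=> k s1 kn ek fn fr IH.
rewrite /picking_st pE !nmem_loop // -ek; apply: pick_stepP; rewrite ?ek ?(fn 0) //.
have -> : pick_ready s1 = pick_ready s.
  rewrite /pick_ready (_ : picker s1 = picker s) ?fn ?fr //.
  by apply: funext => a; rewrite /picker !fn.
by [].
Qed.

End Pick.

Section Main.
Variable R : realType.
Implicit Types s : state R.

Definition phase := PSeq trade pick.

Record main_inv c s : Prop := MainInv {
  main_hold : hold_ok (nmem s 0 0 0) ((nmem s 4)^~ 0);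
  main_ok : bundles_ok (nmem s 0 0 0) (nmem s 1 0 0) (rmem s 0)
    ((nmem s 5)^~ 0) (rmem s 1) ((nmem s 6)^~ 0);
  main_allocated : forall x, x < nmem s 1 0 0 ->
    (nmem s 6 x 0 != 0) = (nmem s 5 x 0 < c);
  main_ef1 : forall i j, i < nmem s 0 0 0 -> j < nmem s 0 0 0 ->
    ef1 (nmem s 1 0 0) (rmem s 0 i) ((nmem s 6)^~ 0) (nmem s 4 j 0)
      (rmem s 1 i (nmem s 4 i 0)) (rmem s 1 i (nmem s 4 j 0));
  main_done : forall i, i < nmem s 0 0 0 -> nmem s 9 i 0 <= c }.

Definition main_ready s :=
  (forall i x, i < nmem s 0 0 0 -> x < nmem s 1 0 0 -> (0 <= rmem s 0 i x)%R) /\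
  (forall c, #|[set x : 'I_(nmem s 1 0 0) | nmem s 5 x 0 == c]| <= nmem s 0 0 0).

Lemma phaseP s : let c := nmem s 20 0 0 in
  main_ready s -> main_inv c s -> main_inv c.+1 (sem phase s).
Proof.
move=> c [v0 small] [hok bok alloc ef dn].
rewrite /phase sem_PSeq; set s1 := sem trade s; set s2 := sem pick s1.
have E1 d : d \notin [:: 21; 7; 8; 22; 23; 11; 12; 4; 9; 10] -> nmem s1 d = nmem s d.
  by move=> H; rewrite nmem_sem //; apply: contra H; rewrite /= !inE; lia.
have r1 : rmem s1 = rmem s by apply: funext => d; rewrite rmem_sem.
have E2 d : d \notin [:: 21; 13; 14; 22; 6] -> nmem s2 d = nmem s1 d.
  by move=> H; rewrite nmem_sem //; apply: contra H; rewrite /= !inE; lia.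
have r2 : rmem s2 0 = rmem s1 0 by rewrite rmem_sem.
set n := nmem s 0 0 0 in hok bok alloc ef dn v0 small *.
set m := nmem s 1 0 0 in bok alloc ef v0 small *.
have : trading_st m (rmem s 0) 0 s.
  split=> //; first by move=> i /dn /leq_trans; apply.
  by move=> i ni; rewrite ltnNge dn.
move/tradeP; rewrite -/s1 /trading_st.
rewrite !(E1 0, E1 20, E1 6) // r1 -/n -/c => T.
have [thok tef tdn tord _ tI tne] := T.
have onto := trading_full T.
have pE a : picker s1 a = nmem s1 10 (n - a - 1) 0 by rewrite /picker (E1 0).
have ready : pick_ready s1.
  split; rewrite ?r1 !(E1 0, E1 1) // -/n.
  - by move=> a an; rewrite pE; case: (tord (n - a - 1)) => //; lia.
  - move=> a b an bn; rewrite !pE => e.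
    have : n - a - 1 = n - b - 1 by apply: tI => //; lia.
    lia.
have start : picking_st 0 s1.
  rewrite /picking_st r1 !(E1 0, E1 1, E1 20, E1 5, E1 6) // -/n -/m -/c.
  have pn a : a < n -> picker s1 a < n.
    by move=> an; rewrite pE; case: (tord (n - a - 1)) => //; lia.
  split=> //.
  - by move=> x xm lx; rewrite alloc.
  - by move=> x xm lx; have := alloc x xm; rewrite ltnNge (ltnW lx) => /negbFE/eqP.
  - by move=> x xm lx; rewrite alloc // lx ltnn.
  - rewrite subn0; apply: leq_trans (small c); apply/subset_leq_card/subsetP => x.
    by rewrite !inE => /andP[].
  - by move=> a b an bn; apply: tef; apply: pn.
  - move=> a b _ ba an; rewrite !pE; apply: tne.
    * by lia.
    * by rewrite -pE; apply: pn; lia.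
    * by right; exists (n - b - 1); split=> //; lia.
have := pickP ready start.
rewrite E1 // -/n -/s2 /picking_st r2 r1 !(E2 0, E2 1, E2 20, E2 5, E2 4) //.
rewrite !(E1 0, E1 1, E1 20, E1 5) // -/n -/m -/c.
have -> : picker s2 = picker s1 by apply: funext => a; rewrite /picker !E2.
case=> pok old new _ fr pef _ _.
split; rewrite ?r2 ?r1 !(E2 0, E2 1, E2 5, E2 4, E2 9) // !(E1 0, E1 1, E1 5) //.
- move=> x xm; have [lx|lx|lx] := ltngtP (nmem s 5 x 0) c.
  + by rewrite (old x xm lx) ltnS ltnW.
  + by rewrite (new x xm lx) ltnS leqNgt lx.
  + rewrite lx ltnSn; apply/negP => /eqP bx.
    have : Ordinal xm \in unassigned m c ((nmem s 5)^~ 0) ((nmem s2 6)^~ 0).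
      by rewrite inE /= lx bx !eqxx.
    by move: fr; rewrite subnn leqn0 cards_eq0 => /eqP ->; rewrite inE.
- have ontop i : i < n -> exists2 a, a < n & picker s1 a = i.
    move=> /onto[a an <-]; exists (n - a - 1); first by lia.
    by rewrite pE; congr (nmem s1 10 _ 0); lia.
  by move=> i j /ontop[a an <-] /ontop[b bn <-]; apply: pef.
Qed.

Definition main := PFor 1 20 phase.

Lemma mainP s : main_ready s -> main_inv 0 s ->
  main_inv (nmem s 1 0 0) (sem main s).
Proof.
move=> ready T; have := @sem_PFor R (fun k s1 => main_inv k s1) 1 20 phase
  s isT isT.
apply.
  by case: T => *; split; rewrite ?rmem_nset !nmem_loop.
move=> k s1 kn ek fn fr IH.
suff: main_inv k.+1 (sem phase s1).
  by case=> *; split; rewrite ?rmem_nset !nmem_loop.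
by rewrite -ek; apply: phaseP; rewrite ?ek // /main_ready !fn // fr.
Qed.

Definition assign :=
  PFor 1 20 (PFor 0 21 (PIf (NEq (arr 6 (var 20)) (arr 4 (var 21)))
                            (arrset 3 (var 20) (var 21)))).

Lemma assignP s x i : hold_ok (nmem s 0 0 0) ((nmem s 4)^~ 0) ->
  x < nmem s 1 0 0 -> i < nmem s 0 0 0 -> nmem s 6 x 0 = nmem s 4 i 0 ->
  nmem (sem assign s) 3 x 0 = i.
Proof.
rewrite /assign => hok + ni e; set b := PFor 0 21 _.
have := @sem_PFor R (fun k s1 => x < k -> nmem s1 3 x 0 = i) 1 20 b s isT isT.
apply=> // k s1 km ek fn fr IH; rewrite nmem_loop // ltnS => xk.
suff: i < nmem s1 0 0 0 \/ x < k -> nmem (sem b s1) 3 x 0 = i.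
  by apply; left; rewrite fn.
have := @sem_PFor R (fun k' s2 => (x = k /\ i < k') \/ x < k -> nmem s2 3 x 0 = i)
  0 21 (PIf (NEq (arr 6 (var 20)) (arr 4 (var 21))) (arrset 3 (var 20) (var 21)))
  s1 isT isT.
move=> H H'; apply: H.
- by move=> [[]//|]; rewrite nmem_loop //; apply: IH.
- move=> k' s2 kn' ek' fn' fr' IH'; rewrite nmem_loop //.
  rewrite sem_PIf teval_NEq sem_arrset /= ek' (fn' 20) // ek (fn' 6) // (fn' 4) //.
  rewrite (fn 6) // (fn 4) //; rewrite (fn 0) // in kn'.
  case: eqP => [bE|bE]; last first.
    case=> [[xe ik]|xk']; apply: IH'; last by right.
    left; split=> //; move: ik; rewrite ltnS leq_eqVlt => /predU1P[ie|//].
    by case: bE; rewrite -ie -xe.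
  rewrite nmem_arr; case: eqP => [xe _|xe].
    by rewrite xe bE in e; apply: (proj2 hok) e.
  by case=> [[]//|xk']; apply: IH'; right.
- by case: (ltngtP x k) xk => // [xk _|xe _]; [right | left; split=> //; case: H' => //; lia].
Qed.

End Main.

Definition algorithm :=
  PSeq init_hold (PSeq init_label (PSeq label (PSeq main assign))).

Section Correctness.
Variables (R : realType) (n : nat) (M : finType) (G : graph M).
Variable V : 'I_n -> valuation R M.
Hypothesis small : max_component G <= n.

Lemma item_ord (r : 'I_#|M|) : item M r = Some (enum_val r).
Proof. by rewrite /item valK. Qed.

Lemma item_rank x : item M (enum_rank x) = Some x.
Proof. by rewrite item_ord enum_rankK. Qed.

Definition same_component x y := x = y \/
  exists a b, [/\ item M x = Some a, item M y = Some b & connect G a b].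

Lemma same_component_sym x y : same_component x y -> same_component y x.
Proof.
case=> [->|[a [b [xa yb ab]]]]; [by left | right; exists b, a; split=> //].
by rewrite (sym_connect_sym (@edge_sym _ G)).
Qed.

Lemma same_component_trans x y z :
  same_component x y -> same_component y z -> same_component x z.
Proof.
case=> [->//|[a [b [xa yb ab]]]] [<-|[b' [c [yb' zc bc]]]].
  by right; exists a, b.
right; exists a, c; split=> //; apply: connect_trans ab _.
by move: yb' bc; rewrite yb => -[->].
Qed.

Lemma same_component_connect (r r' : 'I_#|M|) :
  same_component r r' -> connect G (enum_val r) (enum_val r').
Proof.
case=> [/val_inj ->//|[a [b]]].
by rewrite !item_ord => -[[<-] [<-]].
Qed.

Lemma label_class_small (l : nat -> nat) c :
  (forall x y, x < #|M| -> y < #|M| -> l x = l y -> same_component x y) ->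
  #|[set r : 'I_#|M| | l r == c]| <= n.
Proof.
move=> lc; have [->|[r0]] := set_0Vmem [set r : 'I_#|M| | l r == c].
  by rewrite cards0.
rewrite inE => /eqP r0c; apply: leq_trans small.
apply: (leq_trans _ (leq_bigmax (enum_val r0))).
rewrite -(card_imset _ (@enum_val_inj _ M)) subset_leq_card //.
apply/subsetP => _ /imsetP[r + ->]; rewrite !inE => /eqP rc.
by apply: same_component_connect; apply: lc; rewrite ?ltn_ord ?r0c.
Qed.

Lemma input_value (i : 'I_n) (r : 'I_#|M|) :
  rmem (input V G) 0 i r = V i [set enum_val r].
Proof. by rewrite /rmem /input valK item_ord. Qed.

Lemma input_edge x y : nmem (input V G) 2 (enum_rank x) (enum_rank y) = G x y.
Proof. by rewrite /nmem /input !item_rank. Qed.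

Lemma algorithm_EF1 :
  EF1_allocation V G (output n M (sem algorithm (input V G))).
Proof.
rewrite /algorithm !sem_PSeq; set s0 := input V G.
set s1 := sem init_hold s0; set s2 := sem init_label s1.
set s3 := sem label s2; set s4 := sem main s3; set s5 := sem assign s4.
set m := #|M|.
have n0 : nmem s0 0 0 0 = n by [].
have m0 : nmem s0 1 0 0 = m by [].
have E3 d : d \notin [:: 4; 22; 5; 23; 20; 21; 15; 16] -> nmem s3 d = nmem s0 d.
  by move=> H; rewrite !nmem_sem //; apply: contra H; rewrite /= !inE; lia.
have r3 : rmem s3 = rmem s0 by apply: funext => d; rewrite !rmem_sem.
have h3 i : i < n -> nmem s3 4 i 0 = i.+1.
  by move=> ni; rewrite nmem_sem // nmem_sem // init_holdP.
have [lm lc le] : [/\ forall x, x < m -> nmem s3 5 x 0 < m,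
    forall x y, x < m -> y < m -> nmem s3 5 x 0 = nmem s3 5 y 0 ->
      same_component x y &
    forall x y, x < m -> y < m -> nmem s0 2 x y = 1 ->
      nmem s3 5 x 0 = nmem s3 5 y 0].
  have m2 : nmem s2 1 0 0 = m by rewrite !nmem_sem.
  have a2 : nmem s2 2 = nmem s0 2 by rewrite !nmem_sem.
  have := @labelP R s2 same_component; rewrite /= m2 a2; apply.
  - by left.
  - exact: same_component_sym.
  - exact: same_component_trans.
  - move=> x y xm ym; rewrite -[x]/(val (Ordinal xm)) -[y]/(val (Ordinal ym)).
    rewrite -[Ordinal xm]enum_valK -[Ordinal ym]enum_valK /= input_edge => e.
    right; do 2!eexists; split; try exact: item_rank.
    by apply: connect1; case: (G _ _) e.
  - by move=> x xm; rewrite init_labelP // nmem_sem.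
have v0 i x : i < n -> x < m -> (0 <= rmem s0 0 i x)%R.
  move=> ni xm; have := input_value (Ordinal ni) (Ordinal xm) => /= ->.
  exact: value_ge0.
have bun0 x : nmem s3 6 x 0 = 0 by rewrite E3.
have W0 i b : rmem s3 1 i b = 0%R by rewrite r3.
have ready : main_ready s3.
  rewrite /main_ready r3 !(E3 0, E3 1) // n0 m0; split=> // c.
  exact: (@label_class_small (fun x => nmem s3 5 x 0) c lc).
have inv0 : main_inv 0 s3.
  split; rewrite ?(E3 0) // ?(E3 1) // ?n0 ?m0.
  - by split=> [i ni|i j ni nj]; rewrite !h3 //; case.
  - split=> [x xm|x y xm ym|i b ni b0]; rewrite ?bun0 // W0 big_pred0 // => x.
    by rewrite bun0; apply/eqP; lia.
  - by move=> x xm; rewrite bun0.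
  - by move=> i j ni nj; left; rewrite !W0.
  - by move=> i ni; rewrite E3.
have := mainP ready inv0; rewrite -/s4 (E3 1) // m0.
have E4 d : d \notin [:: 20; 21; 22; 23; 4; 7; 8; 9; 10; 11; 12; 13; 14; 6] ->
    nmem s4 d = nmem s3 d.
  by move=> H; rewrite nmem_sem //; apply: contra H; rewrite /= !inE; lia.
have r4 : rmem s4 0 = rmem s0 0 by rewrite rmem_sem // r3.
have n4 : nmem s4 0 0 0 = n by rewrite E4 // E3.
have m4 : nmem s4 1 0 0 = m by rewrite E4 // E3.
case; rewrite n4 m4 r4 (E4 5) // => hok [bn bI Ws] alloc ef _.
pose h := (nmem s4 4)^~ 0; pose bun := (nmem s4 6)^~ 0.
have bunlt x : x < m -> 0 < bun x <= n.
  by move=> xm; rewrite lt0n bn // alloc // lm.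
have ownE (x : M) (i : 'I_n) : (nmem s5 3 (enum_rank x) 0 == i) = (bun (enum_rank x) == h i).
  have xm : enum_rank x < m by apply: ltn_ord.
  have [j nj hj] := hold_onto hok (bunlt _ xm).
  have own : nmem s5 3 (enum_rank x) 0 = j.
    by apply: assignP; rewrite ?n4 ?m4.
  rewrite own -hj; apply/eqP/eqP => [->//|]; exact: (proj2 hok).
have Aval i j : V i (output n M s5 j) = rmem s4 1 i (h j).
  have hj : 0 < h j by case/andP: (proj1 hok j (ltn_ord j)).
  rewrite Ws // value_additive (reindex _ (onW_bij _ (enum_val_bij M))) /=.
  apply: eq_big => [r|r _]; last by rewrite input_value.
  by rewrite ffunE inE ownE enum_valK.
split.
- split=> [i i' ne|].
    rewrite -setI_eq0; apply/eqP/setP => x; rewrite !ffunE !inE.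
    apply/negP => /andP[/eqP-> /eqP/val_inj e].
    by rewrite e eqxx in ne.
  apply/setP => x; rewrite inE; apply/bigcupP.
  have [j nj hj] := hold_onto hok (bunlt _ (ltn_ord (enum_rank x))).
  by exists (Ordinal nj) => //; rewrite ffunE inE ownE /= /h hj.
- move=> i x y; rewrite ffunE !inE !ownE => /eqP bx /eqP yb.
  apply/negP => xy; have xm := ltn_ord (enum_rank x).
  have ym := ltn_ord (enum_rank y).
  suff e : x = y by rewrite e edge_irrefl in xy.
  apply: enum_rank_inj; apply: val_inj; apply: bI => //.
  + by rewrite -lt0n; case/andP: (bunlt _ xm).
  + by apply: le => //; rewrite input_edge xy.
  + by rewrite -/(bun _) bx -yb.
- move=> i i' _; rewrite !Aval lerBlDr.
  have max0 : (0 <= \big[Num.max/0]_(j in output n M s5 i') V i [set j])%R.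
    by elim/big_rec: _ => // j r _ r0; rewrite le_max r0 orbT.
  case: (ef i i' (ltn_ord i) (ltn_ord i')) => [H|[x [xm xb H]]].
    by apply: le_trans H _; rewrite lerDl.
  apply: le_trans H _; rewrite lerD2l.
  have := input_value i (Ordinal xm) => /= ->.
  apply: (le_bigmax_cond _ (fun j => V i [set j])).
  by rewrite ffunE inE ownE enum_valK /= /bun xb.
Qed.

End Correctness.

Theorem proposition2 :
  (forall (R : realType) (n : nat) (M : finType) (G : graph M),
      0 < n -> max_component G <= n ->
      forall V : 'I_n -> valuation R M,
      exists A : {ffun 'I_n -> {set M}}, EF1_allocation V G A)
  /\
  (exists (P : cmd) (c k : nat),
      forall (R : realType) (n : nat) (M : finType) (G : graph M),
      0 < n -> max_component G <= n ->
      forall V : 'I_n -> valuation R M,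
      exists (s : state R) (t : nat),
        [/\ exec P (input V G) s t,
            t <= c * (n + #|M|) ^ k
          & EF1_allocation V G (output n M s)]).
Proof.
split=> [R n M G _ small V|].
  by exists (output n M (sem algorithm (input V G))); apply: algorithm_EF1.
have [c [k poly]] := cost_poly algorithm.
exists (compile algorithm), c, k => R n M G n0 small V.
have [|||t et lt] := @exec_sem R algorithm (input V G) (n + #|M|) => //.
- exact: leq_addr.
- exact: leq_addl.
exists (sem algorithm (input V G)), t; split=> //; last exact: algorithm_EF1.
by apply: leq_trans lt (poly _ _); rewrite addn_gt0 n0.
Qed.
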